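(* Let $1\le r<n$ and $d\ge0$. Then the chain $(\mathrm{Div}(\Delta_n^d),<)$ is obtained by concatenating $h_r(\Delta_n^d)$ intervals, each of which, when equipped with $\preccurlyeq$, is a translated copy of some initial sublattice of $(\mathrm{Div}(\Delta_r^d),\preccurlyeq)$. That is, $\mathrm{Div}(\Delta_n^d)$ is the disjoint union of $h_r(\Delta_n^d)$ nonempty $<$-intervals $C$ such that, for each of them, there are $a\in C$ and an initial sublattice $L$ of $(\mathrm{Div}(\Delta_r^d),\preccurlyeq)$ for which $x\mapsto ax$ is an isomorphism of $(L,\preccurlyeq)$ onto $(C,\preccurlyeq)$.
   Context: Braids. $B_n$ ($n\ge1$) is the braid group with generators $\sigma_1,\dots,\sigma_{n-1}$ and relations $\sigma_i\sigma_j=\sigma_j\sigma_i$ for $|i-j|\ge2$, $\sigma_i\sigma_j\sigma_i=\sigma_j\sigma_i\sigma_j$ for $|i-j|=1$; $B_\infty$ is the direct limit of the $B_n$. $B_n^+$, $B_\infty^+$ are the monoids with the same presentations; they embed in the groups and their elements are called positive braids. For positive braids, $x\preccurlyeq y$ means $y=xt$ for some positive braid $t$, and $\mathrm{Div}(y)=\{x\in B_\infty^+ : x\preccurlyeq y\}$; this is a finite lattice for $\preccurlyeq$. $\Delta_1=1$ and $\Delta_n=\sigma_1\sigma_2\cdots\sigma_{n-1}\Delta_{n-1}$. An initial sublattice of $(\mathrm{Div}(\Delta_r^d),\preccurlyeq)$ is a nonempty sublattice that is closed under taking left divisors. Ordering and heights. The main generator of a nonempty word in the $\sigma_i^{\pm1}$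 is $\sigma_m$ where $m$ is the largest index such that $\sigma_m$ or $\sigma_m^{-1}$ occurs; the word is $\sigma$-positive if its main generator $\sigma_m$ occurs but $\sigma_m^{-1}$ does not. For braids $x,y$, $x<y$ means that $x^{-1}y$ has a $\sigma$-positive expression; it is known that $<$ is a strict linear order on $B_\infty$. For $r\ge1$, $x<_r y$ means that $x^{-1}y$ has a $\sigma$-positive expression whose main generator is $\sigma_m$ with $m\ge r$. The $r$-height $h_r(z)$ of a positive braid $z$ is the maximal length (number of elements) of a $<_r$-chain contained in $\mathrm{Div}(z)$. *)

(* Defs.v *)
From HB Require Import structures.
From mathcomp Require Import all_boot finmap.
From mathcomp Require Import boolp classical_sets functions.

Set Implicit Arguments.
Unset Strict Implicit.
Unset Printing Implicit Defensive.

Local Open Scope classical_set_scope.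
Local Open Scope quotient_scope.
Local Open Scope group_scope.

Inductive congruence (A : Type) (rel : seq A -> seq A -> Prop) :
    seq A -> seq A -> Prop :=
| cong_rel u v : rel u v -> congruence rel u v
| cong_refl u : congruence rel u u
| cong_sym u v : congruence rel u v -> congruence rel v u
| cong_trans u v w :
    congruence rel u v -> congruence rel v w -> congruence rel u w
| cong_cat u u' v v' : congruence rel u u' -> congruence rel v v' ->
    congruence rel (u ++ v) (u' ++ v').

Definition congruenceb (A : choiceType) (rel : seq A -> seq A -> Prop) :
  simpl_rel (seq A) := [rel u v | `[< congruence rel u v >]].

Lemma congruenceb_equiv (A : choiceType) (rel : seq A -> seq A -> Prop) :
  equiv_class_of (congruenceb rel).
Proof.
split=> [u|u v|v u w] /=; first exact/asboolP/cong_refl.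
  by apply/asboolP/asboolP; apply: cong_sym.
by move=> /asboolP uv /asboolP vw; apply/asboolP; apply: cong_trans vw.
Qed.

Canonical congruence_equiv (A : choiceType) (rel : seq A -> seq A -> Prop) :=
  EquivRelPack (congruenceb_equiv rel).

(* The monoid presented by generators A and relations rel.  It is a group as
   soon as the relations make every generator invertible. *)
Definition presented (A : choiceType) (rel : seq A -> seq A -> Prop) : Type :=
  {eq_quot (congruence_equiv rel)}.

HB.instance Definition _ (A : choiceType) (rel : seq A -> seq A -> Prop) :=
  Choice.on (presented rel).
HB.instance Definition _ (A : choiceType) (rel : seq A -> seq A -> Prop) :=
  EqQuotient.on (presented rel).

Lemma presented_eqP (A : choiceType) (rel : seq A -> seq A -> Prop)
    (u v : seq A) :
  \pi_(presented rel) u = \pi_(presented rel) v <-> congruence rel u v.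
Proof.
split=> [/eqquotP /asboolP //|uv].
by apply/eqquotP; apply/asboolP.
Qed.

Lemma congruence_repr (A : choiceType) (rel : seq A -> seq A -> Prop)
    (u : seq A) : congruence rel (repr (\pi_(presented rel) u)) u.
Proof. by apply/presented_eqP; rewrite reprK. Qed.

Definition presented_mul (A : choiceType) (rel : seq A -> seq A -> Prop)
    (x y : presented rel) : presented rel :=
  \pi_(presented rel) (repr x ++ repr y).

Definition presented_one (A : choiceType) (rel : seq A -> seq A -> Prop) :
  presented rel := \pi_(presented rel) [::].

Lemma presented_mul_pi (A : choiceType) (rel : seq A -> seq A -> Prop)
    (u v : seq A) :
  presented_mul (\pi_(presented rel) u) (\pi_(presented rel) v)
  = \pi_(presented rel) (u ++ v).
Proof. by apply/presented_eqP; apply: cong_cat; apply: congruence_repr. Qed.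

Lemma presented_mulA (A : choiceType) (rel : seq A -> seq A -> Prop) :
  associative (@presented_mul A rel).
Proof.
move=> x y z; apply/presented_eqP.
apply: (@cong_trans _ _ _ (repr x ++ repr y ++ repr z)).
  by apply: cong_cat; [exact: cong_refl | exact: congruence_repr].
rewrite catA; apply/cong_sym/cong_cat; last exact: cong_refl.
exact: congruence_repr.
Qed.

Lemma presented_mul1 (A : choiceType) (rel : seq A -> seq A -> Prop) :
  left_id (presented_one rel) (@presented_mul A rel).
Proof. by move=> x; rewrite -(reprK x) presented_mul_pi. Qed.

Lemma presented_mulr1 (A : choiceType) (rel : seq A -> seq A -> Prop) :
  right_id (presented_one rel) (@presented_mul A rel).
Proof. by move=> x; rewrite -(reprK x) presented_mul_pi cats0. Qed.

HB.instance Definition _ (A : choiceType) (rel : seq A -> seq A -> Prop) :=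
  isMonoid.Build (presented rel)
    (@presented_mulA A rel) (@presented_mul1 A rel) (@presented_mulr1 A rel).

Lemma presented_piM (A : choiceType) (rel : seq A -> seq A -> Prop)
    (u v : seq A) :
  \pi_(presented rel) (u ++ v)
  = (\pi_(presented rel) u * \pi_(presented rel) v)%g.
Proof. exact/esym/presented_mul_pi. Qed.

Lemma presented_pi1 (A : choiceType) (rel : seq A -> seq A -> Prop) :
  \pi_(presented rel) [::] = 1%g.
Proof. by []. Qed.

(* Generators are numbered from 0: the letter i stands for sigma_(i+1). *)
Inductive braid_relation : seq nat -> seq nat -> Prop :=
| braid_far i j : i.+1 < j -> braid_relation [:: i; j] [:: j; i]
| braid_near i : braid_relation [:: i; i.+1; i] [:: i.+1; i; i.+1].

(* The monoid of positive braids on infinitely many strands. *)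
Definition pbraid : Type := presented braid_relation.
HB.instance Definition _ := Monoid.on pbraid.
HB.instance Definition _ := EqQuotient.on pbraid.

(* The letter (i, true) stands for sigma_(i+1), (i, false) for its inverse. *)
Definition pos_letter (i : nat) : nat * bool := (i, true).
Definition inv_letter (l : nat * bool) : nat * bool := (l.1, ~~ l.2).

Inductive braid_group_relation :
    seq (nat * bool) -> seq (nat * bool) -> Prop :=
| group_braid u v : braid_relation u v ->
    braid_group_relation (map pos_letter u) (map pos_letter v)
| group_free l : braid_group_relation [:: l; inv_letter l] [::].

(* The braid group B_infty: the direct limit of the B_n has as presentation
   the union of their presentations. *)
Definition braid : Type := presented braid_group_relation.
HB.instance Definition _ := Monoid.on braid.
HB.instance Definition _ := EqQuotient.on braid.

Definition inv_word (w : seq (nat * bool)) : seq (nat * bool) :=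
  rev (map inv_letter w).

Lemma inv_letterK : involutive inv_letter.
Proof. by case=> i b; rewrite /inv_letter /= negbK. Qed.

Lemma inv_wordK : involutive inv_word.
Proof. by move=> w; rewrite /inv_word map_rev revK (mapK inv_letterK). Qed.

Lemma cong_cat_inv_word (w : seq (nat * bool)) :
  congruence braid_group_relation (w ++ inv_word w) [::].
Proof.
elim: w => [|l w IH]; first exact: cong_refl.
have -> : (l :: w) ++ inv_word (l :: w)
    = [:: l] ++ (w ++ inv_word w) ++ [:: inv_letter l].
  by rewrite /inv_word /= rev_cons -cats1 -catA.
apply: cong_trans (cong_rel (group_free l)).
apply: (@cong_cat _ _ [:: l] [:: l]); first exact: cong_refl.
by apply: (cong_cat IH); apply: cong_refl.
Qed.

Definition braid_inv (x : braid) : braid := \pi_braid (inv_word (repr x)).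

Lemma braid_mulV : right_inverse 1 braid_inv ( *%g : braid -> braid -> braid).
Proof.
move=> x; rewrite -{1}[x]reprK /braid_inv -presented_piM.
exact/presented_eqP/cong_cat_inv_word.
Qed.

Lemma braid_Vmul : left_inverse 1 braid_inv ( *%g : braid -> braid -> braid).
Proof.
move=> x; rewrite -{2}[x]reprK /braid_inv -presented_piM.
rewrite -{2}[repr x]inv_wordK.
exact/presented_eqP/cong_cat_inv_word.
Qed.

HB.instance Definition _ := hasInv.Build braid braid_inv.
HB.instance Definition _ := Monoid_isGroup.Build braid braid_Vmul braid_mulV.

(* The canonical morphism from positive braids to braids. *)
Definition pbraid_braid (x : pbraid) : braid :=
  \pi_braid (map pos_letter (repr x)).

Lemma congruence_pos_letter (u v : seq nat) :
  congruence braid_relation u v ->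
  congruence braid_group_relation (map pos_letter u) (map pos_letter v).
Proof.
elim=> {u v}.
- by move=> u v uv; apply/cong_rel/group_braid.
- by move=> u; apply: cong_refl.
- by move=> u v _; apply: cong_sym.
- by move=> u v w _ uv _; apply: cong_trans.
- by move=> u u' v v' _ uu' _ vv'; rewrite !map_cat; apply: cong_cat.
Qed.

Lemma pbraid_braid_pi (u : seq nat) :
  pbraid_braid (\pi_pbraid u) = \pi_braid (map pos_letter u).
Proof. exact/presented_eqP/congruence_pos_letter/congruence_repr. Qed.

Lemma pbraid_braidM : {morph pbraid_braid : x y / x * y}.
Proof.
move=> x y; rewrite -(reprK x) -(reprK y) -presented_piM.
by rewrite !pbraid_braid_pi map_cat presented_piM.
Qed.

Lemma pbraid_braid1 : pbraid_braid 1 = 1.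
Proof. by rewrite -[1]presented_pi1 pbraid_braid_pi. Qed.

HB.instance Definition _ := isUMagmaMorphism.Build pbraid braid pbraid_braid
  (conj pbraid_braid1 pbraid_braidM).

(* sigma i is the generator sigma_(i+1) of the literature. *)
Definition sigma (i : nat) : pbraid := \pi_pbraid [:: i].

(* Delta_n is only meaningful for n > 0; Delta 0 = Delta 1 = 1. *)
Fixpoint Delta (n : nat) : pbraid :=
  if n is n'.+1 then (\big[*%g/1]_(i < n') sigma i) * Delta n' else 1.

Definition ldiv (x y : pbraid) : Prop := exists t : pbraid, y = x * t.

Definition Div (z : pbraid) : set pbraid := [set x | ldiv x z].

(* With letters numbered from 0, the main generator of a nonempty word w is
   sigma_((main_index w).+1). *)
Definition main_index (w : seq (nat * bool)) : nat := \max_(l <- w) l.1.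

Definition sigma_positive (w : seq (nat * bool)) : bool :=
  [&& w != [::], (main_index w, true) \in w & (main_index w, false) \notin w].

Definition braid_lt (x y : braid) : Prop :=
  exists w, sigma_positive w /\ \pi_braid w = x^-1 * y.

Definition braid_ltr (r : nat) (x y : braid) : Prop :=
  exists w, [/\ sigma_positive w, r <= (main_index w).+1
              & \pi_braid w = x^-1 * y].

Definition pbraid_lt (x y : pbraid) : Prop :=
  braid_lt (pbraid_braid x) (pbraid_braid y).

Definition pbraid_ltr (r : nat) (x y : pbraid) : Prop :=
  braid_ltr r (pbraid_braid x) (pbraid_braid y).

Definition is_chain (T : Type) (lt : T -> T -> Prop) (S : set T) : Prop :=
  forall x y, S x -> S y -> [\/ x = y, lt x y | lt y x].

Definition chain_length (r : nat) (z : pbraid) (k : nat) : Prop :=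
  exists S : {fset pbraid},
    [/\ [set` S] `<=` Div z, is_chain (pbraid_ltr r) [set` S] & #|` S|%fset = k].

(* If the lengths had no maximum, the value would be the default 0, which is
   never a maximum since singletons are chains. *)
Definition height (r : nat) (z : pbraid) : nat :=
  xget 0%N [set h | chain_length r z h /\
                    forall k, chain_length r z k -> (k <= h)%N].

Definition is_meet (D : set pbraid) (x y m : pbraid) : Prop :=
  [/\ D m, ldiv m x, ldiv m y
    & forall u, D u -> ldiv u x -> ldiv u y -> ldiv u m].

Definition is_join (D : set pbraid) (x y m : pbraid) : Prop :=
  [/\ D m, ldiv x m, ldiv y m
    & forall u, D u -> ldiv x u -> ldiv y u -> ldiv m u].

Definition is_sublattice (D L : set pbraid) : Prop :=
  L `<=` D /\
  forall x y, L x -> L y ->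
    (exists2 m, is_meet D x y m & L m) /\ (exists2 m, is_join D x y m & L m).

Definition initial_sublattice (D L : set pbraid) : Prop :=
  [/\ L !=set0, is_sublattice D L & forall x y, L x -> ldiv y x -> L y].

Definition is_interval (T : Type) (lt : T -> T -> Prop) (D C : set T) : Prop :=
  C `<=` D /\
  forall x y z, C x -> C z -> D y -> lt x y -> lt y z -> C y.

Definition ldiv_isomorphism (L C : set pbraid) (f : pbraid -> pbraid) : Prop :=
  set_bij L C f /\
  forall x y, L x -> L y -> (ldiv x y <-> ldiv (f x) (f y)).

(* Main.v *)
(* The proof rests on the dichotomy between braids of B_r and braids with a
   sigma-positive or sigma-negative expression of main generator at least r.

   No sigma-positive word is trivial: braid words act on sequences of pairs of
   positive rationals by a subtraction-free form of Dynnikov's formulas, and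
   sigma_(m+1) strictly decreases a coordinate fixed by all sigma_i, i <= m.

   Comparability inside D = Div(z): let x and y be reached from a common
   a in D by paths in which sigma_m occurs only positively, the other letters
   being lower.  If both paths use sigma_m, they reach it at elements a1, a2
   connected by lower letters, hence comparable by induction on m, say a1 to a2;
   Garside's lcms carry sigma_m along this path within D, so that a1 sigma_m can
   replace a.  It is greater than a, and D is finite, so this terminates.

   Hence the classes of D modulo B_r are totally ordered by <_r, and a <_r-chain
   meets each class at most once: there are h_r(z) classes, and they are
   <-intervals.  By confluence of right division by sigma_1, ..., sigma_(r-1),
   each class has a least element a for left divisibility and is
   {a p in D : p in B_r^+}.  Finally, if a p divides Delta_n^d, then p is a left
   divisor of Delta_n^d, hence of Delta_r^d when p is in B_r^+. *)
Require Import Defs.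
From HB Require Import structures.
From mathcomp Require Import all_boot all_order all_algebra finmap.
From mathcomp Require Import boolp classical_sets functions.
From mathcomp Require Import zify ring lra.

Set Implicit Arguments.
Unset Strict Implicit.
Unset Printing Implicit Defensive.

Local Open Scope quotient_scope.

(** * No sigma-positive word is trivial *)

Section Dynnikov.
Import Order.TTheory GRing.Theory Num.Theory.
Local Open Scope ring_scope.

(* The action of a generator in Dynnikov's formulas, with maximum and sum lifted
   to sum and product: piecewise-linear identities become rational ones. *)
Definition dynn (b : bool) (p q : rat * rat) : (rat * rat) * (rat * rat) :=
  if b then
    let d := p.2 * q.1 + p.1 * (1 + p.2) * (1 + q.2) in
    ((p.1 + p.2 * (p.1 + q.1), q.1 * p.2 * q.2 / d),
     (p.1 * q.1 * q.2 / (p.1 + q.1 + p.1 * q.2), d / q.1))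
  else
    let d := p.1 * p.2 + (1 + p.2) * (1 + q.2) * q.1 in
    ((p.1 * q.1 / (q.1 * (1 + p.2) + p.1 * p.2), p.1 * p.2 * q.2 / d),
     ((p.1 + q.1 * (1 + q.2)) / q.2, d / p.1)).

Definition pos2 (p : rat * rat) := (0 < p.1) && (0 < p.2).

Lemma dynn_pos b p q :
  pos2 p -> pos2 q -> pos2 (dynn b p q).1 && pos2 (dynn b p q).2.
Proof.
case: p q b => [x y] [x' y'] [] /andP[/= x0 y0] /andP[/= x0' y0'];
by rewrite /pos2 /= !(divr_gt0, addr_gt0, mulr_gt0).
Qed.

Ltac pos_field :=
  field; repeat (apply/andP; split);
  apply: lt0r_neq0; rewrite ?(divr_gt0, addr_gt0, mulr_gt0) //.

Lemma dynnK b p q : pos2 p -> pos2 q ->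
  dynn (~~ b) (dynn b p q).1 (dynn b p q).2 = (p, q).
Proof.
case: p q b => [x y] [x' y'] [] /andP[/= x0 y0] /andP[/= x0' y0'];
rewrite /dynn /=; congr ((_, _), (_, _)); pos_field.
Qed.

Lemma dynn_braid p q r : pos2 p -> pos2 q -> pos2 r ->
  let d1 := dynn true p q in
  let d2 := dynn true d1.2 r in
  let d3 := dynn true d1.1 d2.1 in
  let e1 := dynn true q r in
  let e2 := dynn true p e1.1 in
  let e3 := dynn true e2.2 e1.2 in
  [/\ d3.1 = e2.1, d3.2 = e3.1 & d2.2 = e3.2].
Proof.
case: p q r => [x y] [x' y'] [x'' y''].
move=> /andP[/= x0 y0] /andP[/= x0' y0'] /andP[/= x0'' y0''].
rewrite /dynn /=; split; congr (_, _); pos_field.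
Qed.

(** This strict drop is what detects [sigma]-positivity. Once denominators are cleared, the
    difference of the two sides is [x' * x + x' * x']. *)
Lemma dynn_decr p q : pos2 p -> pos2 q -> (dynn true p q).2.1 < q.1.
Proof.
case: p q => [x y] [x' y'] /andP[/= x0 y0] /andP[/= x0' y0'].
rewrite ltr_pdivrMr ?(addr_gt0, mulr_gt0) //.
have := mulr_gt0 x0' x0; have := mulr_gt0 x0' x0'; nra.
Qed.

#[local] Opaque dynn.

Definition dact (v : nat -> rat * rat) (l : nat * bool) : nat -> rat * rat :=
  fun k => if k == l.1 then (dynn l.2 (v l.1) (v l.1.+1)).1
           else if k == l.1.+1 then (dynn l.2 (v l.1) (v l.1.+1)).2
           else v k.

Definition posv (v : nat -> rat * rat) := forall k, pos2 (v k).

Lemma dact_pos v l : posv v -> posv (dact v l).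
Proof.
move=> v0 k; rewrite /dact.
by have /andP[] := dynn_pos l.2 (v0 l.1) (v0 l.1.+1); do 2?case: ifP.
Qed.

Lemma foldl_dact_pos w v : posv v -> posv (foldl dact v w).
Proof. by elim: w v => //= l w IH v v0; exact/IH/dact_pos. Qed.

Lemma dact_inv v l : posv v -> dact (dact v l) (inv_letter l) = v.
Proof.
move=> v0; apply/funext => k; case: l => i b; rewrite /dact /= !eqxx.
rewrite (gtn_eqF (ltnSn i)) dynnK //=.
by case: eqP => [->//|_]; case: eqP => [->|].
Qed.

Lemma dact_far v i j : (i.+1 < j)%N ->
  dact (dact v (i, true)) (j, true) = dact (dact v (j, true)) (i, true).
Proof.
move=> ij; apply/funext => k; rewrite /dact /=.
have -> : (j == i) = false by lia.
have -> : (j == i.+1) = false by lia.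
have -> : (j.+1 == i) = false by lia.
have -> : (j.+1 == i.+1) = false by lia.
have -> : (i == j) = false by lia.
have -> : (i == j.+1) = false by lia.
have -> : (i.+1 == j) = false by lia.
have -> : (i.+1 == j.+1) = false by lia.
case: (k =P j) => [->|kj].
  have -> : (j == i) = false by lia.
  by have -> : (j == i.+1) = false by lia.
case: (k =P j.+1) => [->|kj'] //.
have -> : (j.+1 == i) = false by lia.
by have -> : (j.+1 == i.+1) = false by lia.
Qed.

Lemma dact_near v i : posv v ->
  dact (dact (dact v (i, true)) (i.+1, true)) (i, true) =
  dact (dact (dact v (i.+1, true)) (i, true)) (i.+1, true).
Proof.
move=> v0; apply/funext => k.
have := dynn_braid (v0 i) (v0 i.+1) (v0 i.+2).
rewrite /dact /= !eqxx.
have -> : (i.+1 == i) = false by lia.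
have -> : (i.+2 == i) = false by lia.
have -> : (i.+2 == i.+1) = false by lia.
have -> : (i == i.+1) = false by lia.
have -> : (i == i.+2) = false by lia.
case=> E1 E2 E3.
case: (eqVneq k i) => [->|ki].
  have -> : (i == i.+1) = false by lia.
  by have -> : (i == i.+2) = false by lia.
case: (eqVneq k i.+1) => [_|_] //.
by case: eqVneq.
Qed.

(** The relations hold on positive sequences and positivity is preserved, so the action descends to
    the braid group. *)
Lemma foldl_dact_congr u v : congruence braid_group_relation u v ->
  forall s, posv s -> foldl dact s u = foldl dact s v.
Proof.
elim=> {u v} //.
- move=> _ _ [_ _ [i j ij|i]|l] s s0 /=.
  + exact: dact_far.
  + exact: dact_near.
  + exact: dact_inv.
- by move=> u v _ IH s s0; rewrite IH.
- by move=> u v w _ IH1 _ IH2 s s0; rewrite IH1 ?IH2.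
- move=> u u' v v' _ IH1 _ IH2 s s0.
  by rewrite !foldl_cat IH1 // IH2 //; exact: foldl_dact_pos.
Qed.


(* [low m] selects the letters of B_(m+1), and [mono m] those of them that may
   occur in a sigma-positive word of main generator sigma_m (letter m - 1). *)
Definition low (m : nat) (l : nat * bool) := (l.1 < m)%N.
Definition mono (m : nat) (l : nat * bool) :=
  (l.1.+1 < m)%N || (l.1.+1 == m) && l.2.

(** Letters below [m] act on coordinates at most [m], and [(m, false)] is excluded by [mono m.+1].
    The form [?= iff] keeps the equality case, so that the estimate composes along a word. *)
Lemma dact_mono s l m : posv s -> mono m.+1 l ->
  (dact s l m.+1).1 <= (s m.+1).1 ?= iff (l != (m, true)).
Proof.
move=> s0; rewrite /mono ltnS eqSS; case: l => i b /= /orP[im|/andP[/eqP-> ->]].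
  rewrite /dact /=; have -> : (m.+1 == i) = false by lia.
  have -> : (m.+1 == i.+1) = false by lia.
  apply/leifP; rewrite ifT //; apply/negP => /eqP[im1]; lia.
rewrite /dact /= (gtn_eqF (ltnSn m)) !eqxx.
exact/leifP/dynn_decr.
Qed.

Lemma foldl_dact_mono w s m : posv s -> all (mono m.+1) w ->
  (foldl dact s w m.+1).1 <= (s m.+1).1 ?= iff ((m, true) \notin w).
Proof.
elim: w s => [|l w IH] s s0 /=; first by move=> _; exact/leif_refl.
move=> /andP[lm wm]; rewrite in_cons negb_or andbC eq_sym.
exact: leif_trans (IH _ (dact_pos _ s0) wm) (dact_mono s0 lm).
Qed.

(** On the constant sequence 1, a trivial word would fix coordinate [m.+1], which one occurrence of
    [(m, true)] makes strictly smaller. *)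
Lemma mono_word_neq1 w m : all (mono m.+1) w -> (m, true) \in w ->
  \pi_braid w <> 1%g.
Proof.
move=> wm mw; rewrite -presented_pi1 => /presented_eqP /foldl_dact_congr.
pose s (k : nat) : rat * rat := (1, 1).
have s0 : posv s by move=> k.
move=> /(_ s s0) /= E; have := foldl_dact_mono s0 wm.
by rewrite E mw => -[_]; rewrite eqxx.
Qed.

End Dynnikov.

Local Open Scope classical_set_scope.
Local Open Scope group_scope.

(** * Cancellation in the monoid of positive braids *)

(** A congruence is generated, as an equivalence, by single relations applied inside a context.
    Carrying the context [p], [q] through the induction splits a concatenation into two successive
    changes. *)
Lemma congruence_step_ind (A : Type) (rel Q : seq A -> seq A -> Prop) :
  (forall u, Q u u) -> (forall u v, Q u v -> Q v u) ->
  (forall u v w, Q u v -> Q v w -> Q u w) ->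
  (forall p q u v, rel u v -> Q (p ++ u ++ q) (p ++ v ++ q)) ->
  forall u v, congruence rel u v -> Q u v.
Proof.
move=> Qxx Qsym Qtrans Qstep u v uv.
suff H p q : Q (p ++ u ++ q) (p ++ v ++ q).
  by have := H [::] [::]; rewrite /= !cats0.
elim: uv p q => {u v} //.
- by move=> u v uv p q; apply: Qstep.
- by move=> u v _ IH p q; apply: Qsym.
- by move=> u v w _ IH1 _ IH2 p q; apply: Qtrans (IH1 p q) (IH2 p q).
- move=> u u' v v' _ IH1 _ IH2 p q.
  apply: (Qtrans _ (p ++ u' ++ v ++ q)).
    by have := IH1 p (v ++ q); rewrite -!catA.
  by have := IH2 (p ++ u') q; rewrite -!catA.
Qed.

(** Multiplicities of letters are not invariant, but length and support are; this makes [len] and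
    [below] independent of the representative. *)
Lemma braid_congruence_perm u v :
  congruence braid_relation u v -> size u = size v /\ u =i v.
Proof.
move: u v; apply: congruence_step_ind => //.
- by move=> u v [-> uv]; split=> // i; rewrite uv.
- by move=> u v w [-> uv] [-> vw]; split=> // i; rewrite uv.
- move=> p q _ _ [i j _|i]; rewrite !size_cat; split=> // k;
  rewrite !mem_cat !inE.
    by case: (k == i); case: (k == j).
  by case: (k == i); case: (k == i.+1).
Qed.

(** * Length and support of positive braids *)

Definition len (x : pbraid) := size (repr x).
(** With letters numbered from 0, this is membership in the submonoid [B_(m+1)^+]. *)
Definition below (m : nat) (x : pbraid) := all (fun i => i < m) (repr x).

Lemma lenE u : len (\pi_pbraid u) = size u.
Proof.
by have [] := braid_congruence_perm (congruence_repr braid_relation u).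
Qed.

Lemma belowE m u : below m (\pi_pbraid u) = all (fun i => i < m) u.
Proof.
have [_ E] := braid_congruence_perm (congruence_repr braid_relation u).
exact: eq_all_r.
Qed.

Lemma pi_cons i u : \pi_pbraid (i :: u) = sigma i * \pi_pbraid u.
Proof. exact: (presented_piM _ [:: i]). Qed.

Lemma sigma_ind (P : pbraid -> Prop) :
  P 1 -> (forall i x, P x -> P (sigma i * x)) -> forall x, P x.
Proof.
move=> P1 PS x; rewrite -(reprK x); elim: (repr x) => // i u IH.
by rewrite -cat1s presented_piM; apply: PS.
Qed.

Lemma sigma_ind_r (P : pbraid -> Prop) :
  P 1 -> (forall i x, P x -> P (x * sigma i)) -> forall x, P x.
Proof.
move=> P1 PS x; rewrite -(reprK x); elim/last_ind: (repr x) => // u i IH.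
by rewrite -cats1 presented_piM; apply: PS.
Qed.

Lemma len1 : len 1 = 0%N. Proof. exact: lenE. Qed.
Lemma len_sigma i : len (sigma i) = 1%N. Proof. exact: lenE. Qed.
Lemma lenM x y : len (x * y) = (len x + len y)%N.
Proof. by rewrite -(reprK x) -(reprK y) -presented_piM !lenE size_cat. Qed.

Lemma len0 x : len x = 0%N -> x = 1.
Proof. by rewrite -{2}(reprK x) => /size0nil->. Qed.

Lemma below1 m : below m 1. Proof. by rewrite -[1]presented_pi1 belowE. Qed.
Lemma below_sigma m i : below m (sigma i) = (i < m).
Proof. by rewrite belowE /= andbT. Qed.
Lemma belowM m x y : below m (x * y) = below m x && below m y.
Proof. by rewrite -(reprK x) -(reprK y) -presented_piM !belowE all_cat. Qed.
Lemma below_le m n x : m <= n -> below m x -> below n x.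
Proof. by move=> mn; apply: sub_all => i im; apply: leq_trans mn. Qed.

Lemma case_sigma x : x = 1 \/ exists i y, x = sigma i * y.
Proof. by elim/sigma_ind: x => [|i x _]; [left | right; exists i, x]. Qed.

Lemma case_sigma_r x : x = 1 \/ exists i y, x = y * sigma i.
Proof. by elim/sigma_ind_r: x => [|i x _]; [left | right; exists i, x]. Qed.

(** * Complements of generators and Garside's cancellation argument *)

Definition far i j := (i.+1 < j) || (j.+1 < i).
Definition near i j := (i.+1 == j) || (j.+1 == i).

Lemma sigma_far i j : far i j -> sigma i * sigma j = sigma j * sigma i.
Proof.
rewrite -!presented_piM => /orP[] ij; apply/presented_eqP.
  by apply: cong_rel; constructor.
by apply/cong_sym/cong_rel; constructor.
Qed.

Lemma sigma_near i j : near i j ->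
  sigma i * (sigma j * sigma i) = sigma j * (sigma i * sigma j).
Proof.
rewrite -[sigma j * _]presented_piM -[sigma i * sigma j]presented_piM.
rewrite -[sigma i * _]presented_piM -[sigma j * _]presented_piM.
move=> /orP[] /eqP<-; apply/presented_eqP.
  by apply: cong_rel; constructor.
by apply/cong_sym/cong_rel; constructor.
Qed.

Lemma farC i j : far i j = far j i. Proof. by rewrite /far orbC. Qed.
Lemma nearC i j : near i j = near j i. Proof. by rewrite /near orbC. Qed.

Lemma sigma_farA i j x : far i j ->
  sigma i * (sigma j * x) = sigma j * (sigma i * x).
Proof. by move=> ij; rewrite !mulgA (sigma_far ij). Qed.

Lemma sigma_nearA i j x : near i j ->
  sigma i * (sigma j * (sigma i * x)) = sigma j * (sigma i * (sigma j * x)).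
Proof. by move=> ij; have := sigma_near ij; rewrite !mulgA => ->. Qed.

(* The right complement: [sigma i * scomp i j] is the least common right
   multiple of [sigma i] and [sigma j]. *)
Definition scomp (i j : nat) : pbraid :=
  if i == j then 1 else if near i j then sigma j * sigma i else sigma j.

Lemma scomp_same i : scomp i i = 1.
Proof. by rewrite /scomp eqxx. Qed.

Lemma scomp_far i j : far i j -> scomp i j = sigma j.
Proof.
rewrite /scomp /far /near => ij.
by case: eqP => [|_]; [lia | case: orP => // H; lia].
Qed.

Lemma scomp_near i j : near i j -> scomp i j = sigma j * sigma i.
Proof.
by rewrite /scomp => ij; rewrite ij; case: eqP ij => // ->; rewrite /near; lia.
Qed.

Variant pair_spec i j : Prop :=
| PairSame of i = j
| PairFar of far i j & far j i & i <> j
| PairNear of near i j & near j i & i <> j.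

Lemma pairP i j : pair_spec i j.
Proof.
case: (eqVneq i j) => [|/eqP ij]; first by constructor 1.
case F: (far i j); first by constructor 2; rewrite // farC.
by constructor 3; rewrite // /near; move: F; rewrite /far; lia.
Qed.

Lemma scomp_lcm i j : sigma i * scomp i j = sigma j * scomp j i.
Proof.
case: (pairP i j) => [->|ij ji _|ij ji _] //.
  by rewrite !scomp_far // sigma_far.
by rewrite !scomp_near // sigma_near.
Qed.

(** Every common multiple of two generators factors through their lcm; the case [s = t] is left
    cancellation. The length bound serves the induction on [n]. *)
Definition factors n := forall s t u v, len u < n ->
  sigma s * u = sigma t * v ->
  exists w, u = scomp s t * w /\ v = scomp t s * w.

Lemma factors_cancel n s u v : factors n -> len u < n ->
  sigma s * u = sigma s * v -> u = v.
Proof. by move=> F un /(F _ _ _ _ un)[w]; rewrite scomp_same => -[-> ->]. Qed.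

Lemma scomp_cancel n r s u v : factors n -> len (scomp r s * u) <= n ->
  scomp r s * u = scomp r s * v -> r = s \/ u = v.
Proof.
move=> F; case: (pairP r s) => [->|rs _ _|rs _ _]; first by left.
  rewrite scomp_far // lenM len_sigma => un E.
  by right; apply: (factors_cancel F un E).
rewrite scomp_near // !lenM !len_sigma -!mulgA => un E; right.
apply: (factors_cancel F (s := r)); first lia.
by apply: (factors_cancel F _ E); rewrite lenM len_sigma; lia.
Qed.

Ltac factor F un E w :=
  let eu := fresh "eu" in let ev := fresh "ev" in
  have [|w [eu ev]] := F _ _ _ _ _ E;
    [move: un; have := congr1 len E; rewrite !(lenM, len_sigma); lia|];
  clear E;
  repeat match goal with
  | H : is_true (far ?i ?j) |- _ => rewrite ?(scomp_far H) in eu ev; revert H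
  | H : is_true (near ?i ?j) |- _ => rewrite ?(scomp_near H) in eu ev; revert H
  end; intros; rewrite -?mulgA in eu ev; subst.

(* Garside's induction step, case by case on the triple [s, r, t]: no three
   distinct generators are pairwise adjacent, which leaves seven cases. *)
Lemma scomp_cube n s r t u v : factors n -> len (scomp r s * u) <= n ->
  scomp r s * u = scomp r t * v ->
  exists w, scomp s r * u = scomp s t * w /\ scomp t r * v = scomp t s * w.
Proof.
move=> F; case: (pairP s t) => [<-|st ts st'|st ts st'].
  move=> un E; case: (scomp_cancel F un E) => [rs|->]; last first.
    by exists (scomp s r * v); rewrite scomp_same mul1g.
  by exists v; move: E; rewrite rs !scomp_same !mul1g => ->.
all: case: (pairP r s) => [->|rs sr rs'|rs sr rs'];
  first by rewrite scomp_same mul1g => _ ->; exists v.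
all: case: (pairP r t) => [<-|rt tr rt'|rt tr rt'];
  first by rewrite scomp_same mul1g => _ <-; exists u.
all: try by (rewrite /far /near in rs sr rt tr st ts; lia).
all: rewrite ?(scomp_far rs) ?(scomp_far sr) ?(scomp_far rt) ?(scomp_far tr)
  ?(scomp_far st) ?(scomp_far ts) ?(scomp_near rs) ?(scomp_near sr)
  ?(scomp_near rt) ?(scomp_near tr) ?(scomp_near st) ?(scomp_near ts) -?mulgA.
all: move=> un E; factor F un E w.
- exists (sigma r * w); rewrite (sigma_farA _ rt).
  by rewrite (sigma_farA _ rs).
- factor F un ev z; exists (sigma r * (sigma t * z)).
  by rewrite (sigma_nearA _ rt) (sigma_farA _ ts) (sigma_farA _ rs).
- factor F un eu z; exists (sigma r * (sigma s * z)).
  by rewrite (sigma_nearA _ rs) (sigma_farA _ st) (sigma_farA _ rt).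
(* Here [r] is adjacent to both [s] and [t], which are far apart. Two different factorisations of
   the same element must first be compared by cancellation. *)
- factor F un eu z; factor F un ev y.
  have E : sigma t * z = sigma s * y.
    apply: (factors_cancel F _ ev0).
    by move: un; rewrite !(lenM, len_sigma); lia.
  factor F un E x; exists (sigma r * (sigma t * (sigma s * (sigma r * x)))).
  split.
    by rewrite (sigma_farA _ st) (sigma_nearA _ sr) (sigma_nearA _ rt).
  rewrite (sigma_farA (sigma r * (sigma t * x)) ts) (sigma_nearA _ tr).
  by rewrite (sigma_nearA _ rs) (sigma_farA _ st).
- exists (sigma r * w); rewrite -!mulgA; split.
    by rewrite (sigma_farA _ rt) (sigma_farA _ rs).
  by rewrite (sigma_farA _ rs) (sigma_farA _ rt).
- factor F un ev z; factor F un ev0 y.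
  exists (sigma r * (sigma t * (sigma s * y))); rewrite -!mulgA; split.
    rewrite (sigma_farA _ sr) (sigma_nearA _ rt) (sigma_nearA _ ts).
    by rewrite (sigma_farA _ rs).
  rewrite (sigma_nearA _ ts) (sigma_farA _ rs) (sigma_farA y sr).
  by rewrite (sigma_nearA _ rt).
- factor F un eu z; factor F un ev y.
  exists (sigma r * (sigma s * (sigma t * y))); rewrite -!mulgA; split.
    rewrite (sigma_nearA _ st) (sigma_farA _ rt) (sigma_farA y tr).
    by rewrite (sigma_nearA _ rs).
  rewrite (sigma_farA _ tr) (sigma_nearA _ rs) (sigma_nearA _ st).
  by rewrite (sigma_farA _ rt).
Qed.

(** A relation applied behind a nonempty prefix keeps the first letter; applied at the front, it
    exhibits the common factor explicitly. Successive steps are composed by [scomp_cube], with [r]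
    the first letter of the intermediate word. *)
Lemma factors_all n : factors n.
Proof.
elim: n => // n F s t u v un E.
pose Q u v := size u = size v /\ (size u <= n.+1 -> forall s t u' v',
  u = s :: u' -> v = t :: v' -> exists w,
    \pi_pbraid u' = scomp s t * w /\ \pi_pbraid v' = scomp t s * w).
have Qcong : forall u v, congruence braid_relation u v -> Q u v.
  apply: congruence_step_ind.
  - move=> u0; split=> // _ i j x y -> [-> ->]; exists (\pi_pbraid y).
    by rewrite scomp_same mul1g.
  - move=> x y [xy H]; split=> // xn i j x' y' ex ey.
        have [|w [-> ->]] := H _ _ _ _ _ ey ex; first by rewrite xy.
    by exists w.
  - move=> x y z [xy Hxy] [yz Hyz]; split; first by rewrite xy.
    move=> xn i j x' z' ex ez.
    case: y xy yz Hxy Hyz => [|k y]; first by rewrite ex.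
    move=> xy yz Hxy Hyz.
    have [a [-> Ea]] := Hxy xn _ _ _ _ ex erefl.
    have [|b [Eb ->]] := Hyz _ _ _ _ _ erefl ez; first by rewrite -xy.
    apply: (scomp_cube F); rewrite -Ea // lenE.
    by move: xn; rewrite xy.
  - move=> [|k p] q x y xy.
      split; first by rewrite !size_cat; case: xy.
      case: xy => [i j ij|i] _ s' t' u' v' [<- <-] [<- <-].
        have ij' : far i j by rewrite /far ij.
        exists (\pi_pbraid q); rewrite (scomp_far ij') scomp_far 1?farC //.
        by rewrite !pi_cons.
      have ij' : near i i.+1 by rewrite /near eqxx.
      exists (\pi_pbraid q); rewrite (scomp_near ij') scomp_near 1?nearC //.
      by rewrite !pi_cons -!mulgA.
    split; first by rewrite !size_cat; case: xy.
    move=> _ s' t' u' v' [<- <-] [<- <-]; exists (\pi_pbraid (p ++ y ++ q)).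
    rewrite scomp_same mul1g; split=> //.
    rewrite !presented_piM; congr (_ * (_ * _)).
    exact/presented_eqP/cong_rel.
have [] : Q (s :: repr u) (t :: repr v).
  apply: Qcong; apply/presented_eqP.
  by rewrite !pi_cons !reprK.
move=> _ H; have [|w] := H _ _ _ _ _ erefl erefl; first exact: un.
by rewrite !reprK; exists w.
Qed.

Lemma sigma_factors s t u v : sigma s * u = sigma t * v ->
  exists w, u = scomp s t * w /\ v = scomp t s * w.
Proof. exact: factors_all (ltnSn _). Qed.

Lemma pbraid_mulI (x y z : pbraid) : x * y = x * z -> y = z.
Proof.
elim/sigma_ind: x => [|i x IH]; first by rewrite !mul1g.
rewrite -!mulgA => /sigma_factors[w []]; rewrite scomp_same !mul1g => E1 E2.
by apply: IH; rewrite E1.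
Qed.

(** * Reversal of words and right factors *)

Definition rv (x : pbraid) : pbraid := \pi_pbraid (rev (repr x)).

(** A braid relation read backwards is again a braid relation, up to symmetry, so reversal is an
    anti-automorphism and carries results on left factors to right factors. *)
Lemma rvE u : rv (\pi_pbraid u) = \pi_pbraid (rev u).
Proof.
apply/presented_eqP; move: (congruence_repr braid_relation u).
apply: (congruence_step_ind
  (Q := fun u v => congruence braid_relation (rev u) (rev v))).
- by move=> *; apply: cong_refl.
- by move=> *; apply: cong_sym.
- by move=> x y z; apply: cong_trans.
- move=> p q x y xy; rewrite !rev_cat.
  do 2?apply: cong_cat; try exact: cong_refl.
  case: xy => [i j ij|i]; last exact/cong_rel/braid_near.
  exact/cong_sym/cong_rel/braid_far.
Qed.

Lemma rvK x : rv (rv x) = x.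
Proof. by rewrite {2}/rv rvE revK reprK. Qed.
Lemma rvM x y : rv (x * y) = rv y * rv x.
Proof.
by rewrite -(reprK x) -(reprK y) -presented_piM !rvE rev_cat presented_piM.
Qed.
Lemma rv_sigma i : rv (sigma i) = sigma i. Proof. exact: rvE. Qed.
Lemma below_rv m x : below m (rv x) = below m x.
Proof. by rewrite -{1}(reprK x) rvE belowE all_rev. Qed.

Lemma sigma_factors_r s t u v : u * sigma s = v * sigma t ->
  exists w, u = w * rv (scomp s t) /\ v = w * rv (scomp t s).
Proof.
move=> /(congr1 rv); rewrite !rvM !rv_sigma => /sigma_factors[w [eu ev]].
by exists (rv w); rewrite -!rvM -eu -ev !rvK.
Qed.

Lemma below_scomp m i j : i < m -> j < m -> below m (scomp i j).
Proof.
move=> im jm; rewrite /scomp; case: ifP => _; first exact: below1.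
by case: ifP => _; rewrite ?belowM !below_sigma ?im ?jm.
Qed.

Lemma lenS_neq1 i x : sigma i * x <> 1.
Proof. by move=> /(congr1 len); rewrite lenM len_sigma len1. Qed.

(** * Lattice structure of left divisibility *)

Lemma ldiv_refl x : ldiv x x. Proof. by exists 1; rewrite mulg1. Qed.
Lemma ldiv1 x : ldiv 1 x. Proof. by exists x; rewrite mul1g. Qed.
Lemma ldiv_mulr x y : ldiv x (x * y). Proof. by exists y. Qed.

Lemma ldiv_trans x y z : ldiv x y -> ldiv y z -> ldiv x z.
Proof. by move=> [a ->] [b ->]; rewrite -mulgA; apply: ldiv_mulr. Qed.

Lemma ldivM a x y : ldiv (a * x) (a * y) <-> ldiv x y.
Proof.
split=> [[t]|[t ->]]; first by rewrite -mulgA => /pbraid_mulI->; exists t.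
by rewrite mulgA; exists t.
Qed.

Lemma ldiv_len x y : ldiv x y -> len x <= len y.
Proof. by move=> [t ->]; rewrite lenM leq_addr. Qed.

Lemma ldiv_len_eq x y : ldiv x y -> len y <= len x -> x = y.
Proof.
move=> [t ->]; rewrite lenM -{2}[len x]addn0 leq_add2l leqn0 => /eqP/len0->.
by rewrite mulg1.
Qed.

Lemma ldiv_below m x y : ldiv x y -> below m y -> below m x.
Proof. by move=> [t ->]; rewrite belowM => /andP[]. Qed.

Lemma ldiv_sigma2 i j x : ldiv (sigma i) x -> ldiv (sigma j) x ->
  ldiv (sigma i * scomp i j) x.
Proof.
move=> [u ->] [v] /sigma_factors[w [-> _]].
by rewrite mulgA; apply: ldiv_mulr.
Qed.

(** Induction on the length of a common multiple. The square on the first letters is closed by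
    [scomp]; the lcms [p] and [q] close the rectangles beside it, and [r] closes the remaining
    corner. *)
Lemma lcm_exists x y z : ldiv x z -> ldiv y z -> exists m,
  [/\ ldiv x m, ldiv y m & forall w, ldiv x w -> ldiv y w -> ldiv m w].
Proof.
have [n] := ubnP (len z); elim: n x y z => // n IH x y z zn.
case: (case_sigma x) => [->|[i [x1 ->]]] xz yz.
  by exists y; split=> //; [apply: ldiv1 | apply: ldiv_refl].
case: (case_sigma y) yz => [->|[j [y1 ->]]] yz.
  by exists (sigma i * x1); split=> //; [apply: ldiv_refl | apply: ldiv1].
have [s ez] : ldiv (sigma i * scomp i j) z.
  by apply: ldiv_sigma2; [case: xz | case: yz] => t ->; rewrite -mulgA;
  apply: ldiv_mulr.
move: zn xz yz; rewrite ez => {z ez}.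
rewrite ltnS lenM lenM len_sigma => zn xz yz.
have eij := scomp_lcm i j.
move: xz; rewrite -mulgA ldivM => xz.
move: yz; rewrite eij -mulgA ldivM => yz.
have lc : len (scomp i j) = len (scomp j i).
  by have := congr1 len eij; rewrite !lenM !len_sigma => -[].
have [|p [xp [p2 ep] pmin]] := IH _ _ _ _ xz (ldiv_mulr _ s).
  by rewrite lenM; lia.
have [|q [yq [q2 eq] qmin]] := IH _ _ _ _ yz (ldiv_mulr _ s).
  by rewrite lenM; lia.
have p2s : ldiv p2 s.
  by have := pmin _ xz (ldiv_mulr _ s); rewrite ep ldivM.
have q2s : ldiv q2 s.
  by have := qmin _ yz (ldiv_mulr _ s); rewrite eq ldivM.
have [|r [p2r q2r rmin]] := IH _ _ _ _ p2s q2s; first lia.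
exists (sigma i * scomp i j * r); split.
- rewrite -mulgA ldivM; apply: ldiv_trans xp _; rewrite ep ldivM //.
- rewrite eij -mulgA ldivM; apply: ldiv_trans yq _; rewrite eq ldivM //.
move=> w xw yw.
have [s' ew] : ldiv (sigma i * scomp i j) w.
  by apply: ldiv_sigma2; [move: xw | move: yw];
  apply: ldiv_trans; apply: ldiv_mulr.
rewrite ew ldivM; apply: rmin.
  move: xw; rewrite ew -mulgA ldivM => xw.
  by have := pmin _ xw (ldiv_mulr _ s'); rewrite ep ldivM.
move: yw; rewrite ew eij -mulgA ldivM => yw.
by have := qmin _ yw (ldiv_mulr _ s'); rewrite eq ldivM.
Qed.

(** Take a common divisor of maximal length: its lcm with any other common divisor is again a common
    divisor, hence no longer. *)
Lemma gcd_exists x y : exists g,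
  [/\ ldiv g x, ldiv g y & forall w, ldiv w x -> ldiv w y -> ldiv w g].
Proof.
pose P n := `[< exists g, [/\ ldiv g x, ldiv g y & len g = n] >].
have P0 : exists n, P n.
  by exists 0%N; apply/asboolP; exists 1; split; rewrite ?len1 //; apply: ldiv1.
have Pmax n : P n -> n <= len x.
  by move=> /asboolP[g [gx _ <-]]; apply: ldiv_len.
case: (ex_maxnP P0 Pmax) => n /asboolP[g [gx gy gn]] nmax.
exists g; split=> // w wx wy.
have [m [gm wm mmin]] := lcm_exists gx wx.
rewrite (ldiv_len_eq gm) // gn; apply: nmax; apply/asboolP.
by exists m; split=> //; apply: mmin.
Qed.

(** Confluence of right division by the letters below [m], as in Newman's lemma: the last letters
    [i] and [j] lead to a common [w], and induction on length closes the three smaller diamonds. *)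
Lemma lower_bound m a b p q : below m p -> below m q -> a * p = b * q ->
  exists c p' q', [/\ below m p', below m q', a = c * p' & b = c * q'].
Proof.
have [n] := ubnP (len (a * p)); elim: n a b p q => // n IH a b p q.
case: (case_sigma_r p) => [->|[i [p1 ->]]].
  rewrite mulg1 => _ _ qm ->; exists b, q, 1.
  by rewrite mulg1; split=> //; apply: below1.
case: (case_sigma_r q) => [->|[j [q1 ->]]].
  rewrite mulg1 => _ pm _ <-; exists a, 1, (p1 * sigma i).
  by rewrite mulg1; split=> //; apply: below1.
rewrite !belowM !below_sigma !lenM len_sigma.
move=> ln /andP[p1m im] /andP[q1m jm].
rewrite !mulgA => /sigma_factors_r[w [ea eb]].
have la := congr1 len ea; have lb := congr1 len eb.
have rm k l : k < m -> l < m -> below m (rv (scomp k l)).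
  by move=> *; rewrite below_rv below_scomp.
rewrite !lenM in la lb.
have [|c1 [p1' [s1 [p1m' s1m ec1 ew1]]]] := IH _ _ _ _ _ p1m (rm _ _ im jm) ea.
  by rewrite lenM; lia.
have lab : len (rv (scomp i j)) = len (rv (scomp j i)).
  have := congr1 len (scomp_lcm i j); rewrite !lenM !len_sigma => -[].
  have lrv x : len (rv x) = len x by rewrite -{1}(reprK x) rvE lenE size_rev.
  rewrite !lrv => E; lia.
have [|c2 [q1' [s2 [q1m' s2m ec2 ew2]]]] := IH _ _ _ _ _ q1m (rm _ _ jm im) eb.
  by rewrite lenM; lia.
have [||c [p' [q' [p'm q'm ec1' ec2']]]] := IH c1 c2 s1 s2 _ s1m s2m _.
- by have := congr1 len ew1; rewrite !lenM; lia.
- by rewrite -ew1.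
exists c, (p' * p1'), (q' * q1'); rewrite !belowM p'm q'm p1m' q1m' !mulgA.
by rewrite -ec1' -ec2'.
Qed.

(** * Divisors of the powers of Delta *)

Definition up (k : nat) : pbraid := \big[*%g/1]_(i < k) sigma i.
Fixpoint down (k : nat) : pbraid :=
  if k is k'.+1 then sigma k' * down k' else 1.

Lemma up0 : up 0 = 1. Proof. exact: big_ord0. Qed.
Lemma upS k : up k.+1 = up k * sigma k.
Proof. by rewrite /up big_ord_recr. Qed.
Lemma DeltaS k : Delta k.+1 = up k * Delta k. Proof. by []. Qed.
Lemma downS k : down k.+1 = sigma k * down k. Proof. by []. Qed.
Lemma down0 : down 0 = 1. Proof. by []. Qed.

Lemma mulgACA_comm (u s x d : pbraid) : s * x = x * s ->
  u * s * (x * d) = u * x * (s * d).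
Proof. by move=> sx; rewrite -!mulgA (mulgA s) sx -!mulgA. Qed.

Lemma Delta1 : Delta 1 = 1. Proof. by rewrite DeltaS up0 mul1g. Qed.

Lemma below_up k : below k (up k).
Proof.
elim: k => [|k IH]; first by rewrite up0 below1.
by rewrite upS belowM (below_le _ IH) // below_sigma ltnSn.
Qed.

Lemma below_down k : below k (down k).
Proof.
elim: k => [|k IH]; first by rewrite down0 below1.
by rewrite downS belowM (below_le _ IH) // below_sigma ltnSn.
Qed.

Lemma below_Delta k : below k (Delta k.+1).
Proof.
elim: k => [|k IH]; first by rewrite Delta1 below1.
by rewrite DeltaS belowM below_up (below_le _ IH).
Qed.

Lemma commute_below j m x : m < j -> below m x -> sigma j * x = x * sigma j.
Proof.
move=> mj; elim/sigma_ind: x => [|i x IH]; first by rewrite mulg1 mul1g.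
rewrite belowM below_sigma => /andP[im xm].
have ij : far j i by rewrite /far; lia.
by rewrite (sigma_farA _ ij) IH // mulgA.
Qed.

Lemma sigma_up i k : i.+1 < k -> sigma i.+1 * up k = up k * sigma i.
Proof.
elim: k => // k IH; rewrite ltnS upS leq_eqVlt => /orP[/eqP<-|ik]; last first.
  have ki : far k i by rewrite /far ik orbT.
  by rewrite mulgA IH // -!mulgA (sigma_far ki).
have ii : near i i.+1 by rewrite /near eqxx.
rewrite upS -!mulgA (sigma_near ii) [LHS]mulgA.
by rewrite (commute_below _ (below_up i)) // -mulgA.
Qed.

Lemma sigma_down i k : i.+1 < k -> sigma i * down k = down k * sigma i.+1.
Proof.
elim: k => // k IH; rewrite ltnS !downS leq_eqVlt.
move=> /orP[/eqP<-|ik]; last first.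
  have ki : far i k by rewrite /far ik.
  by rewrite (sigma_farA _ ki) IH // mulgA.
have ii : near i i.+1 by rewrite /near eqxx.
rewrite downS -!mulgA -(commute_below _ (below_down i)) //.
by rewrite (sigma_nearA _ ii).
Qed.

Lemma Delta_down k : Delta k.+2 = Delta k.+1 * down k.+1.
Proof.
elim: k => [|k IH].
  by rewrite DeltaS Delta1 upS downS up0 down0 !mul1g mulg1.
rewrite [LHS]DeltaS {1}IH upS mulgACA_comm //.
exact: commute_below (below_Delta k).
Qed.

Lemma sigma_Delta i k : i < k ->
  sigma i * Delta k.+1 = Delta k.+1 * sigma (k.-1 - i).
Proof.
elim: k i => // k IH [|i] ik; last first.
  rewrite DeltaS mulgA sigma_up // -(mulgA (up _)) IH // mulgA.
  by congr (_ * sigma _); lia.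
case: k IH {ik} => [|k] IH.
  by rewrite DeltaS Delta1 upS up0 mul1g !mulg1.
rewrite Delta_down mulgA IH // -mulgA sigma_down; last by lia.
by rewrite mulgA; congr (_ * sigma _); lia.
Qed.

Lemma below_Delta_r k x : below k x ->
  exists2 y, below k y & x * Delta k.+1 = Delta k.+1 * y.
Proof.
elim/sigma_ind: x => [|i x IH].
  by move=> _; exists 1; rewrite ?mul1g ?mulg1 ?below1.
rewrite belowM below_sigma => /andP[ik /IH[y yk E]].
exists (sigma (k.-1 - i) * y); first by rewrite belowM yk below_sigma; lia.
by rewrite -mulgA E mulgA sigma_Delta // -mulgA.
Qed.

Lemma below_DeltaX_r k d x : below k x ->
  exists2 y, below k y & x * Delta k.+1 ^+ d = Delta k.+1 ^+ d * y.
Proof.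
elim: d x => [|d IH] x xk; first by exists x; rewrite ?expg0 ?mulg1 ?mul1g.
have [y yk E] := below_Delta_r xk; have [z zk E'] := IH y yk.
by exists z => //; rewrite expgS mulgA E -mulgA E' mulgA.
Qed.

Lemma below_DeltaX k d : below k (Delta k.+1 ^+ d).
Proof.
elim: d => [|d IH]; first by rewrite expg0 below1.
by rewrite expgS belowM below_Delta.
Qed.

(** Moving [a] across the power [D] of [Delta] gives [a * D = D * b = a * u * b], and [a]
    cancels. *)
Lemma ldiv_DeltaX_right k d a u : a * u = Delta k.+1 ^+ d ->
  ldiv u (Delta k.+1 ^+ d).
Proof.
move=> E.
have ak : below k a.
  by apply: ldiv_below (below_DeltaX k d); rewrite -E; apply: ldiv_mulr.
have [b _] := below_DeltaX_r d ak; rewrite -{2}E -mulgA => /pbraid_mulI->.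
exact: ldiv_mulr.
Qed.

Lemma sigma_ldiv_Delta i k : i < k -> ldiv (sigma i) (Delta k.+1).
Proof.
elim: k i => // k IH i; rewrite ltnS leq_eqVlt => /orP[/eqP->|ik]; last first.
  by rewrite Delta_down; apply: ldiv_trans (IH _ ik) (ldiv_mulr _ _).
(* The top generator is the flip of [sigma 0], so its divisibility follows from that of
   [sigma 0]. *)
have [y E] : ldiv (sigma 0) (Delta k.+2).
  case: k IH => [|k] IH; rewrite Delta_down.
    by rewrite Delta1 mul1g downS; apply: ldiv_mulr.
  by apply: ldiv_trans (IH 0%N _) (ldiv_mulr _ _).
have [|z _ E'] := @below_Delta_r k.+1 y.
  by have := below_Delta k.+1; rewrite E belowM => /andP[].
exists z; apply: (@pbraid_mulI (Delta k.+2)).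
by rewrite {1}E -mulgA E' mulgA sigma_Delta // subn0 mulgA.
Qed.

Lemma below_ldiv_DeltaX k x : below k x -> ldiv x (Delta k.+1 ^+ len x).
Proof.
elim/sigma_ind: x => [|i x IH]; first by move=> _; apply: ldiv1.
rewrite belowM below_sigma => /andP[ik /IH[y E]].
have [u Eu] := sigma_ldiv_Delta ik.
have [|v _ Ev] := @below_DeltaX_r k (len x) u.
  by have := below_Delta k; rewrite Eu belowM => /andP[].
exists (y * v); rewrite lenM len_sigma add1n expgS {1}Eu -mulgA Ev E.
by rewrite !mulgA.
Qed.

Lemma ldiv_far_strip j m p w : m < j -> below m p ->
  ldiv (sigma j) (p * w) -> ldiv (sigma j) w.
Proof.
move=> mj; elim/sigma_ind: p => [|i p IH]; first by rewrite mul1g.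
rewrite belowM below_sigma => /andP[im pm] [v].
have ji : far j i by rewrite /far; lia.
rewrite -mulgA => /esym /sigma_factors[u [_]].
by rewrite scomp_far 1?farC // => E; apply: IH => //; exists u.
Qed.

(** A converse of [sigma_down] for divisibility: taking lcms with the letters of [down k] one at a
    time carries [sigma i] across as [sigma i.+1]. *)
Lemma ldiv_down_strip i k w : i.+1 < k ->
  ldiv (sigma i) (down k * w) -> ldiv (sigma i.+1) w.
Proof.
elim: k => // k IH; rewrite ltnS leq_eqVlt downS => /orP[/eqP<-|ik] [v].
  rewrite -mulgA => /sigma_factors[u [+ _]].
  have ii : near i.+1 i by rewrite /near eqxx orbT.
  rewrite scomp_near // downS -!mulgA => /pbraid_mulI E.
  by apply: ldiv_far_strip (below_down i) _ => //; exists u.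
have ki : far k i by rewrite /far ik orbT.
rewrite -mulgA => /sigma_factors[u [+ _]]; rewrite scomp_far // => E.
by apply: IH => //; exists u.
Qed.

Lemma ldiv_up_strip i k w : i.+1 < k ->
  ldiv (sigma i.+1) (up k * w) -> ldiv (sigma i) w.
Proof.
elim: k w => // k IH w; rewrite ltnS leq_eqVlt upS -mulgA => /orP[/eqP<-|ik].
  rewrite upS -mulgA => /(ldiv_far_strip (ltnSn i) (below_up i)) [v].
  have ii : near i i.+1 by rewrite /near eqxx.
  move=> /sigma_factors[u [+ _]].
  rewrite scomp_near // -mulgA => /pbraid_mulI->.
  exact: ldiv_mulr.
move=> /(IH _ ik) [v] /sigma_factors[u [+ _]].
by rewrite scomp_far => [->|]; [apply: ldiv_mulr|rewrite /far ik orbT].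
Qed.

Lemma down_up_comm i k : i < k -> sigma i * (down k.+1 * up k.+1) =
  down k.+1 * up k.+1 * sigma i.
Proof. by move=> ik; rewrite mulgA sigma_down // -mulgA sigma_up // mulgA. Qed.

Lemma expg_shuffle (a c c' y : pbraid) d :
  a ^+ d.+1 * (c * c') = c * c' * a ^+ d.+1 ->
  a * c * (c' * a) * (a ^+ d * y) = a ^+ d.+2 * (c * c' * y).
Proof.
rewrite !expgS -!mulgA => E; congr (a * _).
by move: E; rewrite !mulgA => ->.
Qed.

(* [Delta k.+2 ^+ 2 = Delta k.+1 * down k.+1 * (up k.+1 * Delta k.+1)], where
   [down k.+1 * up k.+1] commutes with the letters below [k]. *)
Lemma DeltaX_factor k d : exists2 y, Delta k.+2 ^+ d = Delta k.+1 ^+ d * y &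
  forall i, i < k -> ~ ldiv (sigma i) y.
Proof.
have N i : ~ ldiv (sigma i) 1 by move=> [t] /esym /lenS_neq1.
have [n] := ubnP d; elim: n d => // n IH [|[|d]] dn.
- by exists 1; rewrite ?expg0 ?mulg1.
- exists (down k.+1); rewrite ?expg1 ?Delta_down // => i ik.
  rewrite -[down _]mulg1 => /(ldiv_down_strip _) H.
  by apply: (N i.+1); apply: H.
have [|y E yk] := IH d; first by lia.
exists (down k.+1 * up k.+1 * y) => [|i ik].
  have C x : below k x ->
    x * (down k.+1 * up k.+1) = down k.+1 * up k.+1 * x.
    elim/sigma_ind: x => [|i x IHx]; first by rewrite mul1g mulg1.
    rewrite belowM below_sigma => /andP[ik /IHx Ex].
    by rewrite -mulgA Ex mulgA down_up_comm // mulgA.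
  have -> : Delta k.+2 ^+ d.+2 = Delta k.+1 * down k.+1 *
      (up k.+1 * Delta k.+1) * (Delta k.+1 ^+ d * y).
    by rewrite -Delta_down -DeltaS -E !expgS mulgA.
  exact/expg_shuffle/C/below_DeltaX.
(* A divisor [sigma i] would cross [down] as [sigma i.+1], then [up] as [sigma i] again, and so
   divide the previous cofactor. *)
rewrite -mulgA => /ldiv_down_strip H.
by apply: (yk i ik); apply: ldiv_up_strip (H _).
Qed.

(** The lcm of [x] and [Delta k.+1 ^+ d] is [Delta k.+1 ^+ d * u] with [u] in the letters below [k]
    and dividing the cofactor [y]. No such letter divides [y], so [u = 1]. *)
Lemma ldiv_DeltaX_below k d x : below k x -> ldiv x (Delta k.+2 ^+ d) ->
  ldiv x (Delta k.+1 ^+ d).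
Proof.
move=> xk xD; have [y E yk] := DeltaX_factor k d.
have ND : ldiv (Delta k.+1 ^+ d) (Delta k.+2 ^+ d).
  by rewrite E; apply: ldiv_mulr.
have [m [xm [u Eu] mmin]] := lcm_exists xD ND.
suff u1 : u = 1 by move: xm; rewrite Eu u1 mulg1.
have uk : below k u.
  (* This exponent gives a common multiple of [x] and [Delta k.+1 ^+ d] in the letters below [k],
     which confines their lcm to these letters. *)
  have e := below_DeltaX k (maxn d (len x)).
  have mE : ldiv m (Delta k.+1 ^+ maxn d (len x)).
    apply: mmin.
      rewrite -(subnKC (leq_maxr d (len x))) expgnDr.
      exact: ldiv_trans (below_ldiv_DeltaX xk) (ldiv_mulr _ _).
    by rewrite -(subnKC (leq_maxl d (len x))) expgnDr; apply: ldiv_mulr.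
  by have := ldiv_below mE e; rewrite Eu belowM => /andP[].
have uy : ldiv u y.
  by have := mmin _ xD ND; rewrite Eu E ldivM.
case: (case_sigma u) => // -[i [v ev]].
move: uk; rewrite ev belowM below_sigma => /andP[ik _].
by case: (yk i ik); apply: ldiv_trans uy; rewrite ev; apply: ldiv_mulr.
Qed.

Lemma ldiv_DeltaX_le k n d x : k <= n -> below k x ->
  ldiv x (Delta n.+1 ^+ d) -> ldiv x (Delta k.+1 ^+ d).
Proof.
elim: n => [|n IH]; first by rewrite leqn0 => /eqP->.
rewrite leq_eqVlt => /orP[/eqP->//|kn] xk xD.
by apply: IH => //; apply: ldiv_DeltaX_below xD; apply: below_le xk.
Qed.

(** * Comparability of the divisors of a positive braid *)

Lemma count_lt (T : eqType) (p q : pred T) (s : seq T) x :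
  subpred p q -> x \in s -> q x -> ~~ p x -> count p s < count q s.
Proof.
move=> pq xs qx px; elim: s xs => // y s IH; rewrite inE /= => /orP[/eqP<-|].
  by rewrite qx (negPf px) add0n add1n ltnS; apply: sub_count.
move=> /IH lt; have := pq y.
by case: (p y) => [/(_ isT)->|_]; [|case: (q y)]; rewrite ?ltn_add2l //; lia.
Qed.

Definition word_link (P : pred (nat * bool)) (u v : pbraid) :=
  exists2 w, all P w & pbraid_braid u * \pi_braid w = pbraid_braid v.

Definition ltm (m : nat) (u v : pbraid) := exists w,
  [/\ all (mono m.+1) w, (m, true) \in w
    & pbraid_braid u * \pi_braid w = pbraid_braid v].

Lemma ltm_irr m u : ~ ltm m u u.
Proof.
move=> [w [wm mw]]; rewrite -[RHS]mulg1 => /mulgI.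
exact: mono_word_neq1 wm mw.
Qed.

Lemma ltm_link m u v v' : ltm m u v -> word_link (mono m.+1) v v' -> ltm m u v'.
Proof.
move=> [w [wm mw E]] [w' wm' E']; exists (w ++ w').
by rewrite all_cat wm wm' mem_cat mw presented_piM mulgA E E'.
Qed.

Lemma link_ltm m u u' v : word_link (mono m.+1) u u' -> ltm m u' v -> ltm m u v.
Proof.
move=> [w wm E] [w' [wm' mw' E']]; exists (w ++ w').
by rewrite all_cat wm wm' mem_cat mw' orbT presented_piM mulgA E E'.
Qed.

Lemma ltm_trans m u v t : ltm m u v -> ltm m v t -> ltm m u t.
Proof. by move=> uv [w [wm _ wE]]; apply: ltm_link uv _; exists w. Qed.

Section Walks.
Variable z : pbraid.

(** Paths in the Cayley graph that stay inside [Div z], unlike those of [word_link]. A descending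
    edge stays there automatically. *)
Inductive walk (P : pred (nat * bool)) (u : pbraid) : pbraid -> Prop :=
| walk_refl : ldiv u z -> walk P u u
| walk_up v i : walk P u v -> P (i, true) -> ldiv (v * sigma i) z ->
    walk P u (v * sigma i)
| walk_down v i : walk P u (v * sigma i) -> P (i, false) -> walk P u v.

Lemma walk_end P u v : walk P u v -> ldiv v z.
Proof.
by elim=> // {}v i _ + _; apply: ldiv_trans; apply: ldiv_mulr.
Qed.

Lemma walk_start P u v : walk P u v -> ldiv u z.
Proof. by elim. Qed.

Lemma walk_sub (P P' : pred (nat * bool)) u v : subpred P P' ->
  walk P u v -> walk P' u v.
Proof.
move=> PP'; elim=> [uz|t i _ IH /PP' Pi tz|t i _ IH /PP' Pi].
- exact: walk_refl.
- exact: walk_up.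
- exact: walk_down Pi.
Qed.

Lemma walk_cat P u v t : walk P u v -> walk P v t -> walk P u t.
Proof.
move=> uv; elim=> // [{}t i _ IH Pi tz|{}t i _ IH Pi].
  exact: walk_up.
exact: walk_down Pi.
Qed.

Lemma walk_rev (P P' : pred (nat * bool)) u v :
  (forall l, P l -> P' (inv_letter l)) -> walk P u v -> walk P' v u.
Proof.
move=> PP'; elim=> [uz|t i ut IH Pi tz|t i ut IH Pi].
- exact: walk_refl.
- apply: walk_cat IH; apply: (walk_down (i := i)); last exact: PP' Pi.
  exact: walk_refl.
- apply: walk_cat IH; apply: walk_up (PP' _ Pi) (walk_end ut).
  exact/walk_refl/(ldiv_trans _ (walk_end ut))/ldiv_mulr.
Qed.

Lemma walk_word P u v : walk P u v -> word_link P u v.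
Proof.
have S i b : \pi_braid [:: (i, b)] = if b then pbraid_braid (sigma i) else
    (pbraid_braid (sigma i))^-1.
  have E : pbraid_braid (sigma i) = \pi_braid [:: (i, true)].
    exact: pbraid_braid_pi.
  case: b; rewrite E //; apply: (@mulgI _ (\pi_braid [:: (i, true)])).
  rewrite mulgV -presented_piM -presented_pi1; apply/presented_eqP.
  exact/cong_rel/(group_free (i, true)).
elim=> [uz|t i _ [w Pw E] Pi _|t i _ [w Pw E] Pi].
- by exists [::]; rewrite // presented_pi1 mulg1.
- exists (rcons w (i, true)); first by rewrite all_rcons Pi.
  by rewrite -cats1 presented_piM S mulgA E pbraid_braidM.
- exists (rcons w (i, false)); first by rewrite all_rcons Pi.
  by rewrite -cats1 presented_piM S mulgA E pbraid_braidM mulgK.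
Qed.

Lemma walk_low0 u v : walk (low 0) u v -> u = v.
Proof. by elim=> // [{}v|{}v]. Qed.

Lemma walk_low_rev m u v : walk (low m) u v -> walk (low m) v u.
Proof. exact: walk_rev. Qed.

Lemma low_mono m : subpred (low m) (mono m.+1).
Proof. by move=> l; rewrite /low /mono ltnS => ->. Qed.

Lemma mono_low m : subpred (mono m) (low m).
Proof. by move=> l; rewrite /low /mono => /orP[/ltnW|/andP[/eqP<-]]. Qed.

(** The path is cut at its first use of the letter [m]. *)
Lemma walk_mono_split m u v : walk (mono m.+1) u v ->
  walk (low m) u v \/
  exists a, [/\ walk (low m) u a, ldiv (a * sigma m) z
    & walk (mono m.+1) (a * sigma m) v].
Proof.
elim=> [uz|t i ut IH Pi tz|t i ut IH Pi].
- by left; apply: walk_refl.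
- case: IH => [lt|[a [ua az at_]]]; last first.
    by right; exists a; split=> //; apply: walk_up.
  move: Pi; rewrite /mono /= andbT ltnS eqSS => /orP[im|/eqP E].
    by left; apply: walk_up.
  by right; exists t; rewrite E in tz *; split=> //; apply: walk_refl.
- case: IH => [lt|[a [ua az at_]]]; last first.
    by right; exists a; split=> //; apply: walk_down Pi.
  move: Pi; rewrite /mono /= andbF orbF ltnS => im.
  by left; apply: walk_down im.
Qed.

(* [sigma m] is carried along the path by closing, with lcms that divide [z],
   each valley formed by [sigma m] and a letter of the path. *)
Lemma walk_push m a b : walk (mono m) a b -> ldiv (a * sigma m) z ->
  ldiv (b * sigma m) z /\ walk (mono m.+1) (a * sigma m) (b * sigma m).
Proof.
move=> ab az; elim: ab => [_|t i ut [tz tw] Pi tiz|t i ut [tz tw] Pi].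
- by split=> //; apply: walk_refl.
- have [c Ec] : ldiv (t * (sigma i * scomp i m)) z.
    case: tiz tz => w -> [w']; rewrite -!mulgA => /pbraid_mulI.
    move=> /sigma_factors[x [-> _]]; rewrite !mulgA; exact: ldiv_mulr.
  move: Pi; rewrite /mono /= andbT => /orP[im|/eqP im].
    have fim : far i m by rewrite /far im.
    have E : t * sigma i * sigma m = t * sigma m * sigma i.
      by rewrite -!mulgA (sigma_far fim).
    have tz' : ldiv (t * sigma i * sigma m) z.
      by exists c; rewrite Ec scomp_far // mulgA.
    split=> //; rewrite E; apply: walk_up => //; last by rewrite -E.
    by rewrite /mono /= ltnS (ltnW im).
  have nim : near i m by rewrite /near im eqxx.
  have E : t * sigma m * sigma i * sigma m = t * sigma i * sigma m * sigma i.
    by rewrite -!mulgA (sigma_near nim).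
  have tz' : ldiv (t * sigma i * sigma m * sigma i) z.
    by exists c; rewrite Ec scomp_near // !mulgA.
  have tz1 : ldiv (t * sigma i * sigma m) z.
    by apply: ldiv_trans tz'; apply: ldiv_mulr.
  (* The path climbs from [t * sigma m] to the lcm and comes down along [sigma i]. This negative
     letter [i = m - 1] is why the conclusion has [mono m.+1]. *)
  split=> //; apply: (walk_down (i := i)); last by rewrite /mono /= im ltnSn.
  rewrite -E; apply: walk_up; last by rewrite E.
    apply: walk_up => //; first by rewrite /mono /= im ltnSn.
    by apply: ldiv_trans (ldiv_mulr _ (sigma m)) _; rewrite E.
  by rewrite /mono /= eqxx orbT.
- move: Pi; rewrite /mono /= andbF orbF => im.
  have fim : far i m by rewrite /far im.
  have E : t * sigma i * sigma m = t * sigma m * sigma i.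
    by rewrite -!mulgA (sigma_far fim).
  split; first by apply: ldiv_trans tz; rewrite E; apply: ldiv_mulr.
  apply: (walk_down (i := i)); first by rewrite -E.
  by rewrite /mono /= ltnS (ltnW im).
Qed.

Definition either_walk P u v := walk P u v \/ walk P v u.

Lemma ldiv_finite : exists s : seq pbraid, forall x, ldiv x z -> x \in s.
Proof.
have [m zm] : exists m, below m z.
  exists (\max_(i <- repr z) i).+1; apply/allP => i iz.
  by rewrite ltnS (leq_bigmax_seq (F := id)).
pose fix words n : seq (seq nat) := if n is n'.+1 then
  [seq i :: w | i <- iota 0 m, w <- words n'] else [:: [::]].
have wordsP w : all (fun i => i < m) w -> w \in words (size w).
  elim: w => [|i w IH] //= /andP[im wm].
  by apply/allpairsP; exists (i, w); rewrite mem_iota IH.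
exists [seq \pi_pbraid w | n <- iota 0 (len z).+1, w <- words n] => x xz.
apply/allpairsPdep; exists (len x), (repr x); rewrite reprK mem_iota ltnS.
by rewrite ldiv_len // wordsP //; apply: ldiv_below xz zm.
Qed.

Lemma walk_valley m :
  (forall u v, walk (low m) u v -> either_walk (mono m) u v) ->
  forall a u v, walk (mono m.+1) a u -> walk (mono m.+1) a v ->
  either_walk (mono m.+1) u v.
Proof.
move=> T a u v; have [s sP] := ldiv_finite.
(* The termination measure: replacing [a] by a larger divisor loses at least that divisor from the
   count, since [ltm m] is transitive and irreflexive. *)
pose mu a := count (fun d => `[< ltm m a d >]) s.
have mu_lt b b' : walk (low m) b b' -> ldiv (b' * sigma m) z ->
    mu (b' * sigma m) < mu b.
  move=> /walk_word [w wl E] bz.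
  have bb : ltm m b (b' * sigma m).
    exists (rcons w (m, true)); split.
    - rewrite all_rcons /mono eqxx orbT /=.
      by apply: sub_all wl => l /low_mono.
    - by rewrite mem_rcons inE eqxx.
    - rewrite -cats1 presented_piM mulgA E pbraid_braidM; congr (_ * _).
      exact/esym/pbraid_braid_pi.
  apply: (@count_lt _ _ _ _ (b' * sigma m)).
  - by move=> d /asboolP bd; apply/asboolP/(ltm_trans bb bd).
  - exact: sP.
  - exact/asboolP.
  - by apply/asboolPn/ltm_irr.
have [n] := ubnP (mu a); elim: n a u v => // n IH a u v an au av.
have down_low t : walk (low m) a t -> walk (mono m.+1) t a.
  by move=> /walk_low_rev; apply: walk_sub; apply: low_mono.
case: (walk_mono_split au) => [/down_low ua|[a1 [aa1 a1z a1u]]].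
  by left; apply: walk_cat ua av.
case: (walk_mono_split av) => [/down_low va|[a2 [aa2 a2z a2v]]].
  by right; apply: walk_cat va au.
have step b b' t t' : walk (mono m) b b' -> walk (low m) a b ->
    ldiv (b * sigma m) z -> walk (mono m.+1) (b * sigma m) t ->
    walk (mono m.+1) (b' * sigma m) t' -> either_walk (mono m.+1) t t'.
  move=> bb' ab bz bt bt'; have [_ W] := walk_push bb' bz.
  apply: (IH (b * sigma m)) => //; last exact: walk_cat W bt'.
  exact: leq_trans (mu_lt _ _ ab bz) an.
case: (T _ _ (walk_cat (walk_low_rev aa1) aa2)) => a12.
  exact: step a12 aa1 a1z a1u a2v.
by have [] := step _ _ _ _ a12 aa2 a2z a2v a1u; [right|left].
Qed.

(** A zigzag reduces to a single valley: an ascending edge lengthens [q], and a descending one is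
    absorbed by [lower_bound]. *)
Lemma walk_bottom m u v : walk (low m) u v -> exists c p q,
  [/\ below m p, below m q, u = c * p & v = c * q].
Proof.
elim=> [_|t i _ [c [p [q [pm qm eu et]]]] im _|
        t i _ [c [p [q [pm qm eu et]]]] im].
- by exists u, 1, 1; rewrite mulg1 below1.
- exists c, p, (q * sigma i).
  by rewrite belowM qm below_sigma pm et mulgA.
- have im' : below m (sigma i) by rewrite below_sigma.
  have [d [p' [q' [pm' qm' ed et']]]] := lower_bound qm im' (esym et).
  by exists d, (p' * p), q'; rewrite belowM pm' pm eu ed mulgA.
Qed.

Lemma walk_below m (P : pred (nat * bool)) c p :
  (forall i, i < m -> P (i, true)) -> below m p -> ldiv (c * p) z ->
  walk P c (c * p).
Proof.
move=> PP; elim/sigma_ind_r: p => [|i p IH].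
  by rewrite mulg1 => _; apply: walk_refl.
rewrite belowM below_sigma mulgA => /andP[pm im] pz.
by apply: walk_up; rewrite ?PP //; apply: IH => //; apply: ldiv_trans pz;
  apply: ldiv_mulr.
Qed.

(** Both ends are reached by ascending paths from the bottom [c] of the zigzag, and [walk_valley]
    compares them using the previous level. *)
Lemma walk_mono_total m u v : walk (low m) u v -> either_walk (mono m) u v.
Proof.
elim: m u v => [|m IH] u v uv.
  rewrite (walk_low0 uv); left; exact: walk_refl (walk_end uv).
have [c [p [q [pm qm eu ev]]]] := walk_bottom uv.
have P i : i < m.+1 -> mono m.+1 (i, true).
  by rewrite /mono /= andbT orbC -leq_eqVlt.
apply: (walk_valley IH (a := c)).
  by rewrite eu; apply: walk_below P pm _; rewrite -eu; apply: walk_start uv.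
by rewrite ev; apply: walk_below P qm _; rewrite -ev; apply: walk_end uv.
Qed.

End Walks.

(** * The relations [<_r] and trichotomy among divisors *)

Definition ltk k u v := exists2 m, k <= m & ltm m u v.

Lemma low_mono_le k m : k <= m -> subpred (low k) (mono m.+1).
Proof. by move=> km l lk; apply/low_mono/(leq_trans lk). Qed.

(** The larger main generator prevails: the other word uses only lower letters. *)
Lemma ltk_trans k u v t : ltk k u v -> ltk k v t -> ltk k u t.
Proof.
move=> [m km uv] [m' km' vt].
have L i j x y : i < j -> ltm i x y -> word_link (mono j.+1) x y.
  move=> ij [w [wi _ E]]; exists w => //; apply: sub_all wi => l /mono_low.
  by apply: low_mono_le.
case: (ltngtP m m') => mm.
- by exists m' => //; apply: link_ltm vt; apply: L uv.
- by exists m => //; apply: ltm_link uv _; apply: L vt.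
- by exists m => //; apply: ltm_trans uv _; rewrite mm.
Qed.

Lemma ltk_irr k u : ~ ltk k u u.
Proof. by move=> [m _] /ltm_irr. Qed.

Lemma ltk_link k u u' v v' : word_link (low k) u u' -> ltk k u' v' ->
  word_link (low k) v' v -> ltk k u v.
Proof.
move=> [w wk E] [m km uv] [w' wk' E']; exists m => //.
have S := low_mono_le km.
apply: (link_ltm (u' := u')); first by exists w => //; apply: sub_all wk.
by apply: ltm_link uv _; exists w' => //; apply: sub_all wk'.
Qed.

Lemma sigma_positiveP w m : sigma_positive w && (main_index w == m) =
  all (mono m.+1) w && ((m, true) \in w).
Proof.
apply/andP/andP=> [[/and3P[w0 tw fw] /eqP<-]|[wm mw]].
  split=> //; apply/allP => -[i b] ib.
  have im : i <= main_index w.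
    exact: (leq_bigmax_seq (F := fun l : nat * bool => l.1)) ib _.
  rewrite /mono /= ltnS eqSS ltn_neqAle im andbT.
  by case: eqP => //= ei; case: b ib => //; rewrite ei (negPf fw).
have E : main_index w = m.
  apply/eqP; rewrite eqn_leq; apply/andP; split.
    apply/bigmax_leqP_seq => l lw _; have /mono_low := allP wm _ lw.
    by rewrite /low ltnS.
  exact: (leq_bigmax_seq (F := fun l : nat * bool => l.1)) mw _.
rewrite /sigma_positive E mw eqxx; split=> //=; apply/andP; split.
  by apply/eqP => w0; rewrite w0 in mw.
by apply/negP => /(allP wm); rewrite /mono /= ltnn andbF.
Qed.

Lemma pbraid_ltrP k u v : pbraid_ltr k.+1 u v <-> ltk k u v.
Proof.
split=> [[w [wp km E]]|[m km [w [wm mw E]]]].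
  exists (main_index w) => //; exists w.
  have := sigma_positiveP w (main_index w).
  by rewrite wp eqxx => /esym/andP[-> ->]; rewrite E mulgA mulgV mul1g.
exists w; have := sigma_positiveP w m; rewrite wm mw => /andP[-> /eqP->].
by split=> //; rewrite -E mulgA mulVg mul1g.
Qed.

Lemma pbraid_ltP u v : pbraid_lt u v <-> ltk 0 u v.
Proof.
rewrite -pbraid_ltrP; split=> [[w [wp E]]|[w [wp _ E]]]; by exists w.
Qed.

Lemma ltk_le k u v : ltk k u v -> ltk 0 u v.
Proof. by case=> m _; exists m. Qed.

(** Any two divisors are linked through 1 at the level of all letters of [z]. Descending from there
    to level [k], the comparing path either uses its top letter, which decides the order, or stays
    one level lower. *)
Lemma ltk_total k z u v : ldiv u z -> ldiv v z ->
  [\/ walk z (low k) u v, ltk k u v | ltk k v u].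
Proof.
move=> uz vz.
have [m] : exists m, walk z (low m) u v.
  pose m := (\max_(i <- repr z) i).+1; exists m.
  have zm : below m z.
    by apply/allP => i iz; rewrite ltnS (leq_bigmax_seq (F := id)).
  have W x : ldiv x z -> walk z (low m) 1 x.
    move=> xz; rewrite -[x]mul1g.
    by apply: (@walk_below _ m) => //; rewrite ?mul1g //; apply: ldiv_below zm.
  exact: walk_cat (walk_low_rev (W _ uz)) (W _ vz).
have S a b j : walk z (mono j.+1) a b -> k <= j ->
    walk z (low j) a b \/ ltk k a b.
  move=> ab kj; have [|[c [ac cz cb]]] := walk_mono_split ab; first by left.
  right; exists j => //.
  have [w wm E] := walk_word ac; have [w' wm' E'] := walk_word cb.
  exists (w ++ (j, true) :: w'); split.
  - rewrite all_cat /= (sub_all (@low_mono j)) // wm'.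
    by rewrite /mono eqxx orbT.
  - by rewrite mem_cat inE eqxx orbT.
  - rewrite presented_piM -cat1s presented_piM !mulgA E -E' pbraid_braidM.
    by congr (_ * _ * _); apply/esym/pbraid_braid_pi.
elim: m u v {uz vz} => [|m IH] u v uv.
  by constructor 1; apply: walk_sub uv.
case: (leqP k m) => [km|mk]; last first.
  by constructor 1; apply: walk_sub uv => l lm; apply: leq_trans mk.
case: (walk_mono_total uv) => /S /(_ km) [].
- exact: IH.
- by constructor 2.
- by move=> /walk_low_rev; apply: IH.
- by constructor 3.
Qed.

(** * Classes of divisors modulo the lower generators *)

Definition irreducible k a := forall i b, i < k -> a <> b * sigma i.

Definition is_root k x a := irreducible k a /\ exists2 p, below k p & x = a * p.

Lemma root_exists k x : exists a, is_root k x a.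
Proof.
have [n] := ubnP (len x); elim: n x => // n IH x xn.
case: (pselect (irreducible k x)) => [xi|].
  by exists x; split=> //; exists 1; rewrite ?mulg1 ?below1.
move=> /existsNP[i /existsNP[b /not_implyP[ik /contrapT E]]].
have [|a [ai [p pk ep]]] := IH b.
  by move: xn; rewrite E lenM len_sigma; lia.
exists a; split=> //; exists (p * sigma i).
  by rewrite belowM pk below_sigma.
by rewrite E ep mulgA.
Qed.

Definition root k x := sval (cid (root_exists k x)).

Lemma rootP k x : is_root k x (root k x).
Proof. by rewrite /root; case: cid. Qed.

Lemma irreducible_mul k c p : irreducible k (c * p) -> below k p -> p = 1.
Proof.
case: (case_sigma_r p) => // -[i [q ->]] ci.
rewrite belowM below_sigma => /andP[_ ik].
by case: (ci i (c * q) ik); rewrite mulgA.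
Qed.

(** By [lower_bound], [a] and [b] extend a common [c] by letters below [k]; irreducibility makes
    both extensions trivial. *)
Lemma root_unique k a b p q :
  irreducible k a -> irreducible k b -> below k p -> below k q ->
  a * p = b * q -> a = b.
Proof.
move=> + + pk qk E.
have [c [p' [q' [pk' qk' -> ->]]]] := lower_bound pk qk E.
by move=> /irreducible_mul-> // /irreducible_mul->.
Qed.

Lemma is_root_eq k x a b : is_root k x a -> is_root k x b -> a = b.
Proof.
by move=> [ai [p pk ->]] [bi [q qk E]]; apply: root_unique ai bi pk qk E.
Qed.

Lemma root_ldiv k x : ldiv (root k x) x.
Proof. by have [_ [p _ {2}->]] := rootP k x; apply: ldiv_mulr. Qed.

Lemma root_link k z x : ldiv x z -> walk z (low k) (root k x) x.
Proof.
move=> xz; have [_ [p pk ex]] := rootP k x; rewrite [X in walk _ _ _ X]ex.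
by apply: (walk_below (m := k)) => //; rewrite -ex.
Qed.

Lemma root_walk k z x y : walk z (low k) x y -> root k x = root k y.
Proof.
move=> /walk_bottom[c [p [q [pk qk ex ey]]]].
have [c' [ci [t tk ec]]] := root_exists k c.
have rx : is_root k x c'.
  by split=> //; exists (t * p); rewrite ?belowM ?tk // mulgA -ec.
have ry : is_root k y c'.
  by split=> //; exists (t * q); rewrite ?belowM ?tk // mulgA -ec.
by rewrite (is_root_eq (rootP k x) rx) (is_root_eq (rootP k y) ry).
Qed.

Lemma root_id k a : irreducible k a -> root k a = a.
Proof.
move=> ai; apply: is_root_eq (rootP k a) _; split=> //.
by exists 1; rewrite ?below1 ?mulg1.
Qed.

Lemma ltk_root k z x y : ldiv x z -> ldiv y z ->
  ltk k (root k x) (root k y) -> ltk k x y.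
Proof.
move=> xz yz xy.
apply: ltk_link (walk_word (walk_low_rev (root_link k xz))) xy _.
exact: walk_word (root_link k yz).
Qed.

(** With equal roots, a path of low letters from [y] back to [x] would close the comparison into
    [ltk k x x]. *)
Lemma root_neq_ltk k z x y : ldiv x z -> ldiv y z -> ltk k x y ->
  root k x <> root k y.
Proof.
move=> xz yz xy E.
have W : walk z (low k) y x.
  apply: walk_cat (walk_low_rev (root_link k yz)) _.
  by rewrite -E; apply: root_link.
apply: (@ltk_irr k x); apply: ltk_link xy (walk_word W).
by exists [::]; rewrite // presented_pi1 mulg1.
Qed.

(** Irreducible divisors represent the classes. Two of them linked by low letters coincide, so
    [ltk k] is total on them and they can be sorted. *)
Lemma sorted_roots k z : exists A : seq pbraid,
  [/\ forall a, (a \in A) <-> ldiv a z /\ irreducible k a, uniq A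
    & forall i j, i < j < size A -> ltk k (nth 1 A i) (nth 1 A j)].
Proof.
have [s sP] := ldiv_finite z.
pose A0 := [seq a <- undup s | `[< ldiv a z /\ irreducible k a >]].
have A0P a : (a \in A0) <-> ldiv a z /\ irreducible k a.
  rewrite mem_filter mem_undup; split=> [/andP[/asboolP]//|aP].
  by apply/andP; split; [apply/asboolP | apply/sP; case: aP].
pose le a b := (a == b) || `[< ltk k a b >].
have le_tr : transitive le.
  move=> b a c /orP[/eqP->//|/asboolP ab] /orP[/eqP<-|/asboolP bc]; apply/orP.
    by right; apply/asboolP.
  by right; apply/asboolP; apply: ltk_trans ab bc.
have le_tot : {in mem A0 &, total le}.
  move=> a b /A0P[az ai] /A0P[bz bi]; rewrite /le.
  case: (ltk_total k az bz) => [/root_walk|ab|ba].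
  - by rewrite !root_id // => ->; rewrite eqxx.
  - by apply/orP; left; apply/orP; right; apply/asboolP.
  - by apply/orP; right; apply/orP; right; apply/asboolP.
have srt : sorted le (sort le A0) by apply: (sort_sorted_in le_tot); apply/allP.
have uA : uniq (sort le A0) by rewrite sort_uniq filter_uniq ?undup_uniq.
exists (sort le A0); split=> // [a|i j /andP[ij jA]].
  by rewrite mem_sort.
have iA := ltn_trans ij jA.
have := sorted_ltn_nth le_tr 1 srt i j iA jA ij.
by rewrite /le nth_uniq // (ltn_eqF ij) => /asboolP.
Qed.

(** The roots form a chain themselves, and [root k] maps any chain injectively into them. *)
Lemma height_roots k z (A : seq pbraid) :
  (forall a, (a \in A) <-> ldiv a z /\ irreducible k a) -> uniq A ->
  height k.+1 z = size A.
Proof.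
move=> AP uA.
have ch : chain_length k.+1 z (size A).
  exists [fset a in A]%fset; split.
  - by move=> a /=; rewrite !inE => /AP[].
  - move=> a b /=; rewrite !inE => /AP[az ai] /AP[bz bi].
    case: (ltk_total k az bz) => [/root_walk|/pbraid_ltrP ab|/pbraid_ltrP ba].
    + by rewrite !root_id //; constructor 1.
    + by constructor 2.
    + by constructor 3.
  - by rewrite card_fseq undup_id.
have mx j : chain_length k.+1 z j -> j <= size A.
  move=> [S [Sz Sc <-]]; rewrite -(size_map (root k)).
  apply: uniq_leq_size => [|_ /mapP[x xS ->]].
    rewrite map_inj_in_uniq ?fset_uniq // => x y xS yS E.
    have xz := Sz _ xS; have yz := Sz _ yS.
    case: (Sc _ _ xS yS) => // /pbraid_ltrP H.
      by case: (root_neq_ltk xz yz H).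
    by case: (root_neq_ltk yz xz H).
  apply/AP; split; last by have [] := rootP k x.
  exact: ldiv_trans (root_ldiv k x) (Sz _ xS).
rewrite /height; apply: xget_unique => [|j [jc jmx]]; first by split.
by apply/eqP; rewrite eqn_leq mx // jmx.
Qed.

(** * Classes as translated initial sublattices *)

Lemma below_divisors_sublattice k n d a : k <= n ->
  ldiv a (Delta n.+1 ^+ d) ->
  initial_sublattice (Div (Delta k.+1 ^+ d))
    [set p | below k p /\ ldiv (a * p) (Delta n.+1 ^+ d)].
Proof.
move=> kn az.
have sub p : below k p -> ldiv (a * p) (Delta n.+1 ^+ d) ->
    ldiv p (Delta k.+1 ^+ d).
  move=> pk [t]; rewrite -mulgA => E; apply: ldiv_DeltaX_le kn pk _.
  exact: ldiv_trans (ldiv_mulr p t) (ldiv_DeltaX_right (esym E)).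
split.
- by exists 1; rewrite /= mulg1 below1.
- split=> [p [pk pz]|p q [pk pz] [qk qz]]; first exact: sub.
  split.
    have [g [gp gq gmax]] := gcd_exists p q.
    have gk : below k g by apply: ldiv_below gp pk.
    have gz : ldiv (a * g) (Delta n.+1 ^+ d).
      by apply: ldiv_trans pz; apply/ldivM.
    exists g; last by split.
    by split=> [||| u _ up uq] //; [apply: sub | apply: gmax].
  (* Joins are formed among the divisors of the complement [t] of [a], so that the translate by [a]
     remains a divisor. *)
  have [t Et] := az.
  move: (pz) (qz); rewrite {1 2}Et !ldivM => pt qt.
  have [m [pm qm mmin]] := lcm_exists pt qt.
  have mk : below k m.
    by apply: ldiv_below (below_DeltaX k d); apply: mmin; apply: sub.
  have mz : ldiv (a * m) (Delta n.+1 ^+ d).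
    by rewrite Et ldivM; apply: mmin.
  exists m; last by split.
  by split=> [||| u _ pu qu] //; [apply: sub | apply: mmin].
- move=> p q [pk pz] qp; split; first exact: ldiv_below qp pk.
  by apply: ldiv_trans pz; apply/ldivM.
Qed.

Theorem corollary3p6 (r n d : nat) (r_ge1 : (1 <= r)%N) (r_lt_n : (r < n)%N) :
  exists C : 'I_(height r (Delta n ^+ d)) -> set pbraid,
    [/\ \bigcup_i C i = Div (Delta n ^+ d),
        trivIset setT C,
        forall i, C i !=set0 /\ is_interval pbraid_lt (Div (Delta n ^+ d)) (C i),
        forall i j x y, C i x -> C j y -> (i < j)%N -> pbraid_lt x y
      & forall i, exists (a : pbraid) (L : set pbraid),
          [/\ C i a, initial_sublattice (Div (Delta r ^+ d)) L
            & ldiv_isomorphism L (C i) (fun x => a * x)]].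
Proof.
(* With [r = k.+1], the monoid [B_r^+] consists of the braids satisfying [below k]. *)
case: r r_ge1 r_lt_n => // k _; case: n => // n; rewrite ltnS => kn.
set z := Delta n.+1 ^+ d.
have [A [AP uA Alt]] := sorted_roots k z; rewrite (height_roots AP uA).
have nthA (i : 'I_(size A)) : ldiv (nth 1 A i) z /\ irreducible k (nth 1 A i).
  exact/AP/mem_nth.
pose C (i : 'I_(size A)) : set pbraid :=
  [set x | ldiv x z /\ root k x = nth 1 A i].
have CA i : C i (nth 1 A i).
  by have [az ai] := nthA i; split=> //; apply: root_id.
have Cz x : ldiv x z -> exists i, C i x.
  move=> xz.
  have xA : root k x \in A.
    apply/AP; split; first exact: ldiv_trans (root_ldiv k x) xz.
    by have [] := rootP k x.
  have iA : index (root k x) A < size A by rewrite index_mem.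
  by exists (Ordinal iA); split=> //=; rewrite nth_index.
have Clt i j x y : C i x -> C j y -> i < j -> ltk k x y.
  move=> [xz rx] [yz ry] ij; apply: (ltk_root xz yz).
  by rewrite rx ry; apply: Alt; rewrite ij ltn_ord.
exists C; split.
- apply/seteqP; split=> [x [i _ []]//|x /Cz[i Cx]].
  by exists i.
- move=> i j _ _ [x [[_ rx] [_ /eqP]]].
  by rewrite rx nth_uniq // => /eqP/val_inj.
- move=> i; split; first by exists (nth 1 A i).
  split=> [x []//|x y w Cx Cw yz /pbraid_ltP xy /pbraid_ltP yw].
  (* If [y] were in another class, that class would lie entirely on one side of [C i], against
     [x < y < w]. *)
  have [j Cy] := Cz _ yz.
  case: (ltngtP i j) => [ij|ji|/val_inj->//].
    case: (@ltk_irr 0 y); apply: ltk_trans yw _.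
    exact: ltk_le (Clt _ _ _ _ Cw Cy ij).
  case: (@ltk_irr 0 y); apply: ltk_trans _ xy.
  exact: ltk_le (Clt _ _ _ _ Cy Cx ji).
- move=> i j x y Cx Cy ij; apply/pbraid_ltP.
  exact: ltk_le (Clt _ _ _ _ Cx Cy ij).
- move=> i; have [az ai] := nthA i.
  exists (nth 1 A i), [set p | below k p /\ ldiv (nth 1 A i * p) z].
  split=> //; first exact: below_divisors_sublattice (ltnW kn) az.
  split; last by move=> x y _ _; split=> /ldivM.
  split=> [p [pk pz]|x y _ _|x [xz rx]].
  + split=> //; apply: is_root_eq (rootP k _) _.
    by split=> //; exists p.
  + exact: pbraid_mulI.
  + have [_ [p pk]] := rootP k x; rewrite rx => ex.
    by exists p; [split=> //; rewrite -ex | exact: esym].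
Qed.
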